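(* Let $p$ be a prime, let $G$ be a nonabelian $p$-group, and let $\pi$ be a faithful irreducible representation of $G$. Then there exists a K-triple for $\pi$.
   Context: A $p$-group is a finite group of order $p^s$ with $s>0$, $p$ prime. All representations are unitary. Notation: $[w,y] = w^{-1}y^{-1}wy$; $Z(G)$ is the center of $G$; $Z_1(G) = \{y \in G : yZ(G) \in Z(G/Z(G))\}$; $[G,y] = \{[w,y] : w\in G\}$; $\mathbb{Z}_n = \mathbb{Z}/n\mathbb{Z}$. K-triple: Let $G$ be a $p$-group and $\pi$ an irreducible, faithful representation of $G$. A triple $(G_0,r,\tau)$ is a K-triple for $\pi$ if $r\in\mathbb{N}$, $G_0 \lhd G$, $\tau$ is a representation of $G_0$ with $\pi \simeq \mathrm{ind}_{G_0}^G\tau$ (unitary equivalence with the induced representation), and there exist $x\in G$, $y \in Z_1(G)\setminus Z(G)$, $z \in Z(G)$ such that (i) $[x,y]=z$ and $\langle z\rangle = [G,y]\cong \mathbb{Z}_{p^r}$; (ii) $G_0$ is the centralizer of $y$ in $G$; (iii) $G/G_0 = \langle xG_0\rangle \cong \mathbb{Z}_{p^r}$. *)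

(* Defs.v *)
From HB Require Import structures.
From mathcomp Require Import all_boot all_order all_algebra all_fingroup.
From mathcomp Require Import all_solvable spectral mxrepresentation.

Set Implicit Arguments.
Unset Strict Implicit.
Unset Printing Implicit Defensive.

Import GroupScope GRing.Theory Num.Theory.
Local Open Scope ring_scope.

Section UnitaryRepresentations.

Variables (C : numClosedFieldType) (gT : finGroupType).

(* Unitarity is relative to the standard Hermitian product on row vectors. *)
Definition unitary_repr (G : {group gT}) n (rG : mx_representation C G n) :=
  forall g, g \in G -> rG g \is unitarymx.

(* As in mx_rsim, the intertwiner U is typed as a rectangular matrix because n1
   and n2 need not be convertible; n1 = n2 makes it unitary on both sides. *)
Definition unitary_equiv (G : {group gT}) n1 (rG1 : mx_representation C G n1)
    n2 (rG2 : mx_representation C G n2) :=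
  n1 = n2 /\
  exists2 U : 'M[C]_(n1, n2), U \is unitarymx
    & forall g, g \in G -> rG1 g *m U = U *m rG2 g.

Section Induced.

Variables (G H : {group gT}) (m : nat) (tau : mx_representation C H m).

Definition coset_rep (i : 'I_#|rcosets H G|) : gT := repr (enum_val i).

Definition ext0_mx (g : gT) : 'M[C]_m := if g \in H then tau g else 0.

(* For a transversal (t_i) of the right cosets of H in G, the induced module is
   the orthogonal direct sum of copies V t_i of the module V of tau, with
   (v t_i) g = (v tau(t_i g t_j^-1)) t_j for the j such that H t_i g = H t_j. *)
Definition ind_mx (g : gT) : 'M[C]_(\sum_(i < #|rcosets H G|) m) :=
  \mxblock_(i, j) ext0_mx (coset_rep i * g * (coset_rep j)^-1)%g.

Lemma rcoset_coset_rep i : H :* coset_rep i = enum_val i.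
Proof.
rewrite /coset_rep; have /rcosetsP[x Gx ->] := enum_valP i.
by rewrite rcoset_repr.
Qed.

Lemma coset_rep_inj i j : (coset_rep i * (coset_rep j)^-1)%g \in H -> i = j.
Proof.
rewrite -mem_rcoset => /rcoset_eqP; rewrite !rcoset_coset_rep.
exact: enum_val_inj.
Qed.

Lemma coset_rep_ex i g : g \in G ->
  exists j, (coset_rep i * g * (coset_rep j)^-1)%g \in H.
Proof.
move=> Gg; have HG: H :* (coset_rep i * g) \in rcosets H G.
  have := enum_valP i; rewrite -rcoset_coset_rep => /rcosetsP[x Gx Ex].
  rewrite rcosetM Ex -rcosetM; apply/rcosetsP.
  by exists (x * g)%g; rewrite ?groupM.
exists (enum_rank_in HG (H :* (coset_rep i * g))).
by rewrite -mem_rcoset rcoset_coset_rep enum_rankK_in // rcoset_refl.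
Qed.

Lemma ind_mx_repr : mx_repr G ind_mx.
Proof.
split=> [|g h Gg Gh].
  rewrite -mxdiagZ; apply: eq_mxblock => i j; rewrite mulg1 /ext0_mx.
  case: eqVneq => [<-|ne_ij]; first by rewrite mulgV group1 repr_mx1 conform_mx_id.
  by case: ifP => // /coset_rep_inj eq_ij; rewrite eq_ij eqxx in ne_ij.
rewrite /ind_mx mul_mxblock; apply: eq_mxblock => i j.
have [k Hk] := coset_rep_ex i Gg.
rewrite (bigD1 k) //= big1 ?addr0 => [|l ne_lk]; last first.
  rewrite {1}/ext0_mx; case: ifP => [Hl|_]; last by rewrite mul0mx.
  case/eqP: ne_lk; apply: coset_rep_inj.
  by have := groupM (groupVr Hl) Hk; rewrite !invMg !invgK !mulgA !mulgKV.
have ->: (coset_rep i * (g * h) * (coset_rep j)^-1 =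
   coset_rep i * g * (coset_rep k)^-1 * (coset_rep k * h * (coset_rep j)^-1))%g.
  by rewrite !mulgA mulgKV.
rewrite /ext0_mx Hk groupMl //; case: ifP => Hj; last by rewrite mulmx0.
exact: repr_mxM.
Qed.

Definition ind_repr := MxRepresentation ind_mx_repr.

Lemma ind_repr_unitary : unitary_repr tau -> unitary_repr ind_repr.
Proof.
move=> tauU g Gg; apply/unitarymxP => /=.
suff ->: map_mx Num.conj (ind_mx g)^T = ind_mx g^-1.
  by have [i1 iM] := ind_mx_repr; rewrite -iM ?groupV // mulgV i1.
rewrite /ind_mx tr_mxblock; apply/matrixP => a b; rewrite !mxE /ext0_mx.
set x := (_ * g * _)%g; set y := (_ * g^-1 * _)%g.
have ->: y = x^-1%g by rewrite /x /y !invMg invgK mulgA.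
rewrite groupV; case: ifP => Hx; last by rewrite !mxE rmorph0.
by rewrite repr_mxV // invmx_unitary ?tauU // !mxE.
Qed.

End Induced.

End UnitaryRepresentations.

Definition Z1 (gT : finGroupType) (G : {group gT}) : {set gT} :=
  [set y in G | coset 'Z(G) y \in 'Z(G / 'Z(G))].

(* [G, y] denotes the mere set of commutators [~ w, y], not a generated subgroup.
   Zp n, unlike 'Z_n, is the additive group Z/n for every n > 0. *)
Definition K_triple (C : numClosedFieldType) (gT : finGroupType) (p : nat)
    (G : {group gT}) n (pi : mx_representation C G n)
    (G0 : {group gT}) (r m : nat) (tau : mx_representation C G0 m) : Prop :=
  [/\ G0 <| G,
      unitary_repr tau,
      unitary_equiv pi (ind_repr G tau)
    & exists x y z : gT,
        [/\ [/\ x \in G, y \in Z1 G :\: 'Z(G) & z \in 'Z(G)],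
            [/\ [~ x, y] = z,
                <[z]> = [set [~ w, y] | w in G]
              & <[z]> \isog Zp (p ^ r)],
            G0 :=: 'C_G[y],
            G / G0 = <[coset G0 x]>
          & G / G0 \isog Zp (p ^ r)]]%g.

(* Main.v *)
Require Import Defs.
From mathcomp Require Import all_boot all_order all_algebra all_fingroup.
From mathcomp Require Import all_solvable spectral mxrepresentation.
From mathcomp Require Import complex reals.

(** Pick [y] in the second center but not in the center.  Then [w |-> [~ w, y]]
    is a morphism from [G] into ['Z(G)] with kernel ['C_G[y]], and ['Z(G)] is
    cyclic because [pi] is faithful and irreducible; this gives [x] and [z].
    Let [V] be an eigenspace of [pi y].  It is stable under ['C_G[y]], and for
    [s] outside ['C_G[y]] the translate [V s] is an eigenspace of [pi y] for
    another eigenvalue, since the central commutator of [y] and [s] acts by a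
    scalar other than 1; hence it is orthogonal to [V].  By irreducibility the translates of
    [V] span, so [pi] is induced from the action of ['C_G[y]] on [V]. *)

Set Implicit Arguments.
Unset Strict Implicit.
Unset Printing Implicit Defensive.

Import GroupScope GRing.Theory Num.Theory.
Local Open Scope ring_scope.
Local Open Scope sesquilinear_scope.

(** * Commutators with an element of the second center *)

Section SecondCenter.

Variables (gT : finGroupType) (G : {group gT}).

Lemma Z1P y :
  reflect (y \in G /\ {in G, forall w, [~ w, y]%g \in 'Z(G)}) (y \in Z1 G).
Proof.
have nZ : G \subset 'N('Z(G)) by apply: gFnorm.
rewrite inE; apply: (iffP andP) => -[Gy]; have Ny := subsetP nZ _ Gy.
  case/centerP => _ cy; split=> // w Gw; have Nw := subsetP nZ _ Gw.
  rewrite -[_ \in _]/(_ \in gval 'Z(G)%G) coset_idr ?groupR // morphR //.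
  by apply/eqP/commgP/esym/cy; rewrite mem_quotient.
move=> cy; split=> //; apply/centerP; split; first by rewrite mem_quotient.
move=> _ /morphimP[w Nw Gw ->]; apply/esym/commgP.
by rewrite -morphR //= coset_id ?cy.
Qed.

(** The quotient [G / 'Z(G)] is nilpotent, and nontrivial since [G] is not abelian, so its center is
    nontrivial. *)
Lemma Z1_noncentral (p : nat) : (p.-group G)%g -> ~~ abelian G ->
  exists y, y \in (Z1 G :\: 'Z(G))%g.
Proof.
move=> pG nabG; have: 'Z(G / 'Z(G))%g != 1%g.
  rewrite center_nil_eq1 ?quotient_nil ?(pgroup_nil pG) //.
  apply: contra nabG => /eqP/trivgP; rewrite quotient_sub1 ?gFnorm // => sGZ.
  exact: abelianS sGZ (center_abelian G).
case/trivgPn=> _ /[dup] /setIP[/morphimP[y Ny Gy ->] _] Zy nty.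
exists y; apply/setDP; rewrite [y \in Z1 G]inE Gy; split=> //.
by apply: contra nty => yZ; rewrite /= coset_id.
Qed.

Variable y : gT.
Hypothesis Z1y : y \in Z1 G.

(** Since [[w, y]] is central, the conjugation by [v] in [[wv, y] = [w, y]^v [v, y]] has no
    effect. *)
Lemma commg_Z1M : {in G &, {morph commg^~ y : w v / w * v}}%g.
Proof.
have [Gy cy] := Z1P _ Z1y => w v Gw Gv.
have /centerP[_ /(_ v Gv) cwv] := cy w Gw.
by rewrite /= commMgJ conjgE cwv mulKg.
Qed.

Canonical commg_Z1_morphism := Morphism commg_Z1M.

Lemma ker_commg_Z1 : 'ker (commg^~ y) = 'C_G[y].
Proof.
apply/setP=> w; apply/morphpreP/setIP => -[Gw] cwy; split=> //.
  by apply/cent1P/commgP/eqP/set1P.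
by apply/set1P/eqP/commgP/cent1P.
Qed.

Lemma K_triple_elements (p : nat) : prime p -> (p.-group G)%g -> cyclic 'Z(G) ->
  exists r x z,
    [/\ [/\ x \in G, z \in 'Z(G) & [~ x, y] = z],
        <[z]> = [set [~ w, y] | w in G] /\ <[z]> \isog Zp (p ^ r),
        'C_G[y] <| G, G / 'C_G[y] = <[coset 'C_G[y] x]>
      & G / 'C_G[y] \isog Zp (p ^ r)]%g.
Proof.
move=> p_pr pG cycZ; have [Gy cy] := Z1P _ Z1y.
pose f := commg_Z1_morphism.
have imf : f @* G = [set [~ w, y] | w in G]%g by rewrite morphimEdom.
have sfZ : f @* G \subset 'Z(G).
  by rewrite imf; apply/subsetP=> _ /imsetP[w Gw ->]; apply: cy.
have /cyclicP[z defz] := cyclicS sfZ cycZ.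
have fz : z \in f @* G by rewrite defz cycle_id.
have [x _ Gx /= defx] := morphimP fz.
have nK : 'C_G[y] <| G by rewrite -ker_commg_Z1 ker_normal.
have pf : (p.-group (f @* G))%g by rewrite morphim_pgroup.
have [r cardf] := p_natP pf.
have isoK : G / 'C_G[y] \isog f @* G.
  by rewrite -ker_commg_Z1; apply: first_isog.
have isoZ : f @* G \isog Zp (p ^ r).
  rewrite isog_cyclic_card ?(cyclicS sfZ) //= cardf card_Zp; last first.
    by rewrite expn_gt0 prime_gt0.
  rewrite eqxx andbT /Zp; case: ifP => _; last exact: cyclic1.
  by apply/cyclicP; exists Zp1; apply: Zp_cycle.
exists r, x, z; split=> //.
- by split=> //; apply: subsetP fz.
- by rewrite -defz -imf.
- apply/eqP; rewrite eqEsubset cycle_subG mem_quotient // andbT.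
  have nKG := normal_norm nK.
  apply/subsetP=> _ /morphimP[w Nw Gw ->].
  (* From [f w = z ^+ k = f (x ^+ k)], the elements [w] and [x ^+ k] lie in the same coset of the
     kernel. *)
  have /cycleP[k defw] : f w \in <[z]>%g.
    by rewrite -defz mem_morphim.
  apply/cycleP; exists k; rewrite -morphX ?(subsetP nKG) //.
  apply/rcoset_kercosetP; rewrite ?groupX ?(subsetP nKG) //.
  rewrite /= -ker_commg_Z1; apply/rcoset_kerP; rewrite ?groupX //.
  by rewrite morphX //= -defx.
- exact: isog_trans isoK isoZ.
Qed.

End SecondCenter.

(** * Induction from a subspace with orthogonal translates *)

Section Imprimitivity.

Variables (C : numClosedFieldType) (gT : finGroupType) (G : {group gT}).
Variables (n : nat) (pi : mx_representation C G n).

(** For an eigenvalue [a] of [A], the matrix [A - a%:M] also commutes with [pi]. By Schur it is zero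
    or invertible, and it kills an eigenvector. *)
Lemma irr_cent_scalar A : mx_irreducible pi -> centgmx pi A -> is_scalar_mx A.
Proof.
move=> irr /centgmxP cA; have [n_gt0 _] := (mx_irrP pi).1 irr.
have [a /eigenvalueP[v vA v_neq0]] := eigenvalue_closed A n_gt0.
apply/is_scalar_mxP; exists a; apply/eqP; rewrite -subr_eq0.
apply: contraNT v_neq0 => nzAa.
have /mulmxK AaK : A - a%:M \in unitmx.
  apply: (mx_Schur irr) nzAa; apply/centgmxP => g Gg.
  by rewrite mulmxBl mulmxBr cA // scalar_mxC.
by rewrite -[v]AaK mulmxBr vA mul_mx_scalar subrr mul0mx.
Qed.

Hypothesis piU : unitary_repr pi.

Lemma unitary_reprV g : g \in G -> (pi g)^t* = pi g^-1%g.
Proof. by move=> Gg; rewrite repr_mxV // invmx_unitary // piU. Qed.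

Variables (H : {group gT}) (m : nat) (B : 'M[C]_(m, n)).
Hypotheses (sHG : H \subset G) (BU : B \is unitarymx).
Hypothesis BH : {in H, forall h, (B *m pi h <= B)%MS}.

(** When [pi h] preserves the row space of [B], this is the matrix of its restriction in the
    orthonormal basis formed by the rows of [B]. *)
Definition compress_mx (h : gT) : 'M[C]_m := B *m pi h *m B^t*.

Lemma compress_mxK h : h \in H -> compress_mx h *m B = B *m pi h.
Proof.
move=> Hh; rewrite /compress_mx; have /submxP[D ->] := BH Hh.
by rewrite mulmxtVK.
Qed.

Lemma compress_mx_repr : mx_repr H compress_mx.
Proof.
split=> [|g h Hg Hh].
  by rewrite /compress_mx repr_mx1 mulmx1 (unitarymxP BU).
rewrite {1 3}/compress_mx !mulmxA compress_mxK // repr_mxM ?(subsetP sHG) //.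
by rewrite !mulmxA.
Qed.

Definition compress_repr := MxRepresentation compress_mx_repr.

Lemma compress_repr_unitary : unitary_repr compress_repr.
Proof.
move=> h Hh; have Gh := subsetP sHG h Hh; apply/unitarymxP => /=.
suff -> : (compress_mx h)^t* = compress_mx h^-1.
  by rewrite -(repr_mxM compress_repr) ?groupV // mulgV repr_mx1.
rewrite /compress_mx !trmx_mul !map_mxM -unitary_reprV //.
by rewrite trmxCK mulmxA.
Qed.

Lemma coset_rep_mem (i : 'I_#|rcosets H G|) : coset_rep i \in G.
Proof.
rewrite /coset_rep; have /rcosetsP[x Gx ->] := enum_valP i.
have /rcosetP[h Hh ->] := mem_repr_rcoset H x.
by rewrite groupM // (subsetP sHG).
Qed.

Hypothesis Borth : {in G :\: H, forall s, B *m pi s *m B^t* = 0}.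

Definition translates_mx : 'M[C]_(\sum_(i < #|rcosets H G|) m, n) :=
  \mxcol_i (B *m pi (coset_rep i)).

(** For coset representatives [t_i], block [(i, j)] of the Gram matrix is
    [B *m pi (t_i t_j^-1) *m B^t*]. Off the diagonal, [t_i t_j^-1] is outside [H], so [Borth]
    applies. *)
Lemma translates_mx_unitary : translates_mx \is unitarymx.
Proof.
have tU : translates_mx^t* = \mxrow_i (B *m pi (coset_rep i))^t*.
  by apply/matrixP=> a b; rewrite !mxE.
apply/unitarymxP; rewrite tU mul_mxcol_mxrow -mxdiagZ.
apply: eq_mxblock => i j.
have [Gi Gj] := (coset_rep_mem i, coset_rep_mem j).
rewrite trmx_mul map_mxM unitary_reprV // mulmxA -(mulmxA B).
rewrite -repr_mxM ?groupV //.
case: eqVneq => [<-|ne_ij].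
  by rewrite mulgV repr_mx1 mulmx1 conform_mx_id (unitarymxP BU).
apply: Borth; apply/setDP; rewrite groupM ?groupV //; split=> //.
by apply: contraNN ne_ij => /coset_rep_inj ->.
Qed.

Lemma translates_mx_ind g : g \in G ->
  translates_mx *m pi g = ind_repr G compress_repr g *m translates_mx.
Proof.
move=> Gg; rewrite /translates_mx mxcol_mul /= /ind_mx mul_mxblock_mxrow.
(* Exactly one [k] satisfies [t_i g = h t_k] with [h] in [H], so only block [k] survives in the
   sum. *)
apply: eq_mxcol => i; have [k Hk] := coset_rep_ex i Gg.
rewrite (bigD1 k) //= big1 ?addr0 => [|l ne_lk]; last first.
  rewrite /ext0_mx; case: ifP => [Hl|_]; last by rewrite mul0mx.
  case/eqP: ne_lk; apply: coset_rep_inj.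
  by have := groupM (groupVr Hl) Hk; rewrite !invMg !invgK !mulgA !mulgKV.
have [Gi Gk] := (coset_rep_mem i, coset_rep_mem k).
rewrite /ext0_mx Hk mulmxA compress_mxK // -!mulmxA.
by rewrite -!repr_mxM ?(groupM, groupV) // mulgKV.
Qed.

Lemma unitary_equiv_ind : mx_irreducible pi -> (0 < m)%N ->
  unitary_equiv pi (ind_repr G compress_repr).
Proof.
move=> irr m_gt0; set U := translates_mx.
have UU : U \is unitarymx := translates_mx_unitary.
have rkU := mxrank_unitary UU.
have Ufull : row_full U.
  have [_ irrP] := (mx_irrP pi).1 irr.
  rewrite -(eq_row_full (genmxE U)); apply: irrP.
    rewrite (eqmx_module _ (genmxE U)); apply/mxmoduleP=> g Gg.
    by rewrite translates_mx_ind // submxMl.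
  rewrite -mxrank_eq0 genmxE rkU sum_nat_const card_ord muln_eq0 negb_or.
  rewrite -!lt0n m_gt0 andbT.
  apply/card_gt0P; exists (H :* 1%g).
  by rewrite mem_rcosets mulSGid ?group1.
have /row_fullP[L LU] := Ufull.
(* [U] is not typed as a square matrix; its left inverse [L] and its right inverse [U^t*]
   coincide. *)
have UtU : U^t* *m U = 1%:M.
  by rewrite -LU; congr (_ *m _); rewrite -[RHS](mulmxtVK _ UU) LU mul1mx.
split; first by rewrite -(eqP Ufull) rkU.
exists (U^t*); first by apply/unitarymxP; rewrite trmxCK.
move=> g Gg; rewrite -[LHS]mul1mx -UtU -!mulmxA; congr (_ *m _).
by rewrite mulmxA translates_mx_ind // -mulmxA (unitarymxP UU) mulmx1.
Qed.

End Imprimitivity.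

(** * Eigenspaces of a unitary matrix, and the K-triple *)

Lemma eigenspace_unitary_basis (C : numClosedFieldType) n (A : 'M[C]_n) a :
  exists2 B : 'M[C]_(\rank (eigenspace A a), n),
    B \is unitarymx & (B :=: eigenspace A a)%MS.
Proof.
exists (schmidt (row_base (eigenspace A a))).
  by apply: schmidt_unitarymx; apply: rank_leq_col.
by apply: eqmx_trans (eq_row_base _); apply/eqmx_schmidt_free/row_base_free.
Qed.

(** Eigenvalues of a unitary matrix have modulus 1, so the adjoint of a left eigenvector is a right
    eigenvector for the same eigenvalue. *)
Lemma unitary_eigenC (C : numClosedFieldType) m n (P : 'M[C]_n)
    (B : 'M[C]_(m, n)) a : P \is unitarymx -> B \is unitarymx ->
  B *m P = a *: B -> P *m B^t* = a *: B^t*.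
Proof.
move=> PU BU BP.
have PB : a^* *: (P *m B^t*) = B^t*.
  have /(congr1 (fun A : 'M_(m, n) => A^t*)) : a *: (B *m P^t*) = B.
    by rewrite scalemxAl -BP mulmxtVK.
  by rewrite linearZ /= map_mxZ trmx_mul map_mxM trmxCK.
(* An equation between matrices, since [a] is arbitrary when [m = 0]. *)
have a1 : (a * a^*)%:M = 1%:M :> 'M_m.
  rewrite -scalemx1 -(unitarymxP BU) -{2}PB -scalemxAr mulmxA BP -scalemxAl.
  by rewrite scalerA mulrC.
by rewrite -[in RHS]PB scalerA -mul_mx_scalar a1 mulmx1.
Qed.

Theorem lemma26 (R : realType) (gT : finGroupType) (p : nat) (G : {group gT})
    (n : nat) (pi : mx_representation R[i] G n) :
  prime p -> (p.-group G)%g -> ~~ abelian G ->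
  unitary_repr pi -> mx_irreducible pi -> mx_faithful pi ->
  exists (G0 : {group gT}) (r m : nat) (tau : mx_representation R[i] G0 m),
    K_triple p pi r tau.
Proof.
move=> p_pr pG nabG piU irr ffl.
have [y Zy] := Z1_noncentral pG nabG; have [Z1y ncy] := setDP Zy.
have [Gy cy] := Z1P _ _ Z1y.
have cycZ := mx_faithful_irr_center_cyclic ffl irr.
have [r [x [z [[Gx Zz defz] [gen_z iso_z] nK gen_x iso_x]]]] :=
  K_triple_elements Z1y p_pr pG cycZ.
have [n_gt0 _] := (mx_irrP pi).1 irr.
have [a ev_a] := eigenvalue_closed (pi y) n_gt0.
have [B BU defB] := eigenspace_unitary_basis (pi y) a.
have By : B *m pi y = a *: B by apply/eigenspaceP; rewrite defB.
have a_neq0 : a != 0.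
  apply: contraTneq ev_a => a0; apply/eigenvalueP => -[v].
  rewrite a0 scale0r => /(congr1 (mulmx^~ (pi y^-1%g))).
  rewrite mul0mx -mulmxA -repr_mxM ?groupV // mulgV repr_mx1.
  by rewrite mulmx1 => ->; rewrite eqxx.
have yB := unitary_eigenC (piU y Gy) BU By.
have BH : {in 'C_G[y]%G, forall h, (B *m pi h <= B)%MS}.
  move=> h /setIP[Gh /cent1P cyh]; rewrite defB; apply/eigenspaceP.
  by rewrite -mulmxA -repr_mxM // cyh repr_mxM // mulmxA By scalemxAl.
have sKG : 'C_G[y]%G \subset G := normal_sub nK.
have Borth : {in G :\: 'C_G[y]%G, forall s, B *m pi s *m B^t* = 0}.
  move=> s /setDP[Gs nKs]; set M := _ *m _.
  have cGys : [~ y, s]%g \in 'Z(G) by rewrite -invg_comm groupV cy.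
  have /centerP[Gys cys] := cGys.
  have /is_scalar_mxP[c pic] : is_scalar_mx (pi [~ y, s]%g).
    apply: irr_cent_scalar irr _; apply/centgmxP => g Gg.
    by rewrite -!repr_mxM // cys.
  (* If [c = 1], faithfulness makes [y] and [s] commute. *)
  have c_neq1 : c != 1.
    apply: contraNneq nKs => c1; apply/setIP; split=> //.
    have := mx_faithful_inj ffl Gys (group1 G); rewrite pic c1 repr_mx1.
    by move=> /(_ erefl)/eqP/commgP/esym/cent1P.
  (* This product is computed twice: with [y] acting on [B], then, through [ys = sy[y, s]], with [y]
     acting on [B^t*] and an extra factor [c]. Hence [(1 - c) a M = 0]. *)
  have ysM : B *m pi (y * s)%g *m B^t* = a *: M.
    by rewrite repr_mxM // mulmxA By -!scalemxAl.
  have : a *: M = c *: (a *: M).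
    rewrite -{1}ysM (commgC y s) (repr_mxM _ (groupM Gs Gy) Gys) pic.
    rewrite mul_mx_scalar -scalemxAr -scalemxAl repr_mxM // mulmxA.
    by rewrite -(mulmxA _ (pi y)) yB -scalemxAr.
  move/eqP; rewrite -subr_eq0 -{1}[a *: M]scale1r -scalerBl !scaler_eq0.
  by rewrite subr_eq0 eq_sym (negPf c_neq1) (negPf a_neq0) => /eqP.
have rk_gt0 : (0 < \rank (eigenspace (pi y) a))%N by rewrite lt0n mxrank_eq0.
exists 'C_G[y]%G, r, (\rank (eigenspace (pi y) a)), (compress_repr sKG BU BH).
split=> //; first exact: compress_repr_unitary.
  exact: unitary_equiv_ind.
by exists x, y, z; split.
Qed.
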